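(* Let $n \geq 2$ be an integer and let $S_n$ be any slack matrix of the regular $n$-gon. Then, with $k$ the integer such that $2^{k-1} < n \leq 2^k$, $$ \operatorname{rank}_+(S_n) \leq \begin{cases} 2\lceil \log_2(n) \rceil - 1 = 2k-1 & \text{if } 2^{k-1} < n \leq 2^{k-1} + 2^{k-2}, \\ 2 \lceil \log_2(n) \rceil = 2k & \text{if } 2^{k-1} + 2^{k-2} < n \leq 2^k. \end{cases} $$
   Context: Nonnegative rank: for an entrywise nonnegative $m \times n$ real matrix $M$, $\operatorname{rank}_+(M)$ is the minimum $r$ such that there exist an entrywise nonnegative $m \times r$ matrix $U$ and an entrywise nonnegative $r \times n$ matrix $V$ with $M = UV$. Slack matrix: for a polytope $P \subset \mathbb{R}^d$ with $f$ facets described by linear inequalities $a_i^T x \leq b_i$, $1 \leq i \leq f$, and $v$ vertices $x_1, \dots, x_v \in \mathbb{R}^d$, a slack matrix of $P$ is the nonnegative $f \times v$ matrix with entries $b_i - a_i^T x_j$. It is unique up to positive scaling of the inequalities (rows) and permutation of rows and columns, none of which changes the nonnegative rank. For the regular $n$-gon inscribed in the unit circle, one slack matrix is the $n \times n$ circulant matrix whose first row is $(c_0, c_1, \dots, c_{n-1})$, each next row being the previous one shifted cyclically one position to the right, where $c_k = \cos\left(\frac{\pi}{n}\right) - \cos\left((2k+1)\frac{\pi}{n}\right)$. In particular $c_0 = c_{n-1} = 0$. For $n = 2$ the 2-gon is the degenerate case of a line segment. *)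

(* Defs.v *)
From HB Require Import structures.
From mathcomp Require Import all_boot all_order all_algebra.
From mathcomp Require Import all_classical all_reals all_analysis.

Set Implicit Arguments.
Unset Strict Implicit.
Unset Printing Implicit Defensive.

Import Order.TTheory GRing.Theory Num.Theory.
Local Open Scope classical_set_scope.
Local Open Scope ring_scope.

Definition nonneg_mx (R : realType) m n (M : 'M[R]_(m, n)) : Prop :=
  forall i j, 0 <= M i j.

Definition nonneg_factorizable (R : realType) m n (M : 'M[R]_(m, n)) (r : nat) :
    Prop :=
  exists (U : 'M[R]_(m, r)) (V : 'M[R]_(r, n)),
    [/\ nonneg_mx U, nonneg_mx V & M = U *m V].

(* The default value 0 is only taken when M has a negative entry: see
   nonneg_rankP. *)
Definition nonneg_rank (R : realType) m n (M : 'M[R]_(m, n)) : nat :=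
  xget 0%N [set r : nat | nonneg_factorizable M r /\
    forall s : nat, nonneg_factorizable M s -> (r <= s)%N].

Lemma nonneg_rankP (R : realType) m n (M : 'M[R]_(m, n)) : nonneg_mx M ->
  nonneg_factorizable M (nonneg_rank M) /\
  forall s : nat, nonneg_factorizable M s -> (nonneg_rank M <= s)%N.
Proof.
move=> M_ge0; rewrite /nonneg_rank; case: xgetP => [r _ //|no_min].
have exr : exists r, `[< nonneg_factorizable M r >].
  exists n; apply/asboolP; exists M, 1%:M; split=> //; last by rewrite mulmx1.
  by move=> i j; rewrite mxE ler0n.
case: (ex_minnP exr) => r /asboolP Mr r_min.
by case: (no_min r); split=> // s Ms; apply: r_min; apply/asboolP.
Qed.

Definition dotp (R : realType) d (a x : 'cV[R]_d) : R := (a^T *m x) 0 0.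

Definition conv_hull (R : realType) d n (p : 'I_n -> 'cV[R]_d) :
    set 'cV[R]_d :=
  [set y | exists c : 'I_n -> R,
    [/\ forall i, 0 <= c i, \sum_i c i = 1 & y = \sum_i c i *: p i]].

Definition valid_ineq (R : realType) d (P : set 'cV[R]_d) (a : 'cV[R]_d)
    (b : R) : Prop :=
  forall y, P y -> dotp a y <= b.

Definition tight_set (R : realType) d (P : set 'cV[R]_d) (a : 'cV[R]_d)
    (b : R) : set 'cV[R]_d :=
  [set y | P y /\ dotp a y = b].

(* The trivial inequalities 0 <= 0 and 0 <= 1 are allowed, so that P and the
   empty set are faces. *)
Definition face (R : realType) d (P F : set 'cV[R]_d) : Prop :=
  exists (a : 'cV[R]_d) (b : R), valid_ineq P a b /\ F = tight_set P a b.

Definition affinely_independent (R : realType) d m (p : 'I_m -> 'cV[R]_d) :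
    Prop :=
  forall c : 'I_m -> R,
    \sum_i c i = 0 -> \sum_i c i *: p i = 0 -> forall i, c i = 0.

(* aff_rank A m means that A has dimension m - 1: counting points instead of
   subtracting 1 lets the empty set have dimension -1. *)
Definition aff_rank (R : realType) d (A : set 'cV[R]_d) (m : nat) : Prop :=
  (exists p : 'I_m -> 'cV[R]_d, (forall i, A (p i)) /\ affinely_independent p)
  /\ forall q : 'I_m.+1 -> 'cV[R]_d, (forall i, A (q i)) ->
     ~ affinely_independent q.

Definition facet (R : realType) d (P F : set 'cV[R]_d) : Prop :=
  face P F /\ exists m : nat, aff_rank F m /\ aff_rank P m.+1.

Definition vertex (R : realType) d (P : set 'cV[R]_d) (x : 'cV[R]_d) : Prop :=
  face P [set x].

(* The rows are indexed by valid inequalities in bijection with the facets that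
   they define, the columns by an enumeration of the vertices.  If P is not
   full-dimensional, the equations of its affine hull contribute no row. *)
Definition slack_matrix (R : realType) d f v (P : set 'cV[R]_d)
    (S : 'M[R]_(f, v)) : Prop :=
  exists (a : 'I_f -> 'cV[R]_d) (b : 'I_f -> R) (x : 'I_v -> 'cV[R]_d),
    [/\ forall i, valid_ineq P (a i) (b i),
        set_bij [set: 'I_f] (facet P) (fun i => tight_set P (a i) (b i)),
        set_bij [set: 'I_v] (vertex P) x &
        forall i j, S i j = b i - dotp (a i) (x j)].

Definition circle_pt (R : realType) (z : 'cV[R]_2) (r t : R) : 'cV[R]_2 :=
  z + r *: \col_(i < 2) (if i == 0 then cos t else sin t).

(* The regular n-gon inscribed in the circle of center z and radius r, with a
   vertex at angle t; a line segment for n = 2. *)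
Definition regular_ngon (R : realType) (n : nat) (z : 'cV[R]_2) (r t : R) :
    set 'cV[R]_2 :=
  conv_hull (fun j : 'I_n => circle_pt z r (t + 2 * pi * j%:R / n%:R)).

Definition log2 (R : realType) (x : R) : R := ln x / ln 2.

(* Main.v *)
(* A slack of the polygon, as a function of the angle on the circumscribed
   circle, has the form e - a cos x - b sin x.  An arc of m equally spaced
   points is symmetric about its mid-angle p, so it folds onto one of its halves,
   which has uphalf m points.  Reflecting those inequalities whose normal points
   to the other half turns each inequality valid on the arc into one valid on
   the half, and the slack at p + s differs from the new slack at p + |s| by a
   nonnegative multiple of sin |s| that occurs only for one sign of s.  Hence
   halving the number of points costs two in the nonnegative rank.  Iterating
   down to an arc of two or three points gives 2k and 2k - 1. *)

Require Import Defs.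
From HB Require Import structures.
From mathcomp Require Import all_boot all_order all_algebra.
From mathcomp Require Import all_classical all_reals all_analysis.
From mathcomp Require Import ring lra zify.

Set Implicit Arguments.
Unset Strict Implicit.
Unset Printing Implicit Defensive.

Import Order.TTheory GRing.Theory Num.Theory.
Local Open Scope ring_scope.

(* A coordinate-free form of g x = e - a cos x - b sin x, visibly stable under
   reflection. *)
Definition first_harmonic (R : realType) (g : R -> R) : Prop := forall x s,
  g (x + s) - g (x - s) = (g (x + pi / 2) - g (x - pi / 2)) * sin s.

Lemma first_harmonic_trig (R : realType) (a b e : R) :
  first_harmonic (fun x => e - a * cos x - b * sin x).
Proof.
move=> x s; rewrite !(sinD, cosD, sinN, cosN, sin_pihalf, cos_pihalf).
by ring.
Qed.

(** If [g] satisfies [first_harmonic], the single comparison at [pi / 2] fixes the sign of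
    [g (p + s) - g (p - s)] for all [s] in [[0, pi]], so there [fold_at p g (p + s)] is the smaller
    of the two values. *)
Definition fold_at (R : realType) (p : R) (g : R -> R) : R -> R :=
  if g (p + pi / 2) <= g (p - pi / 2) then g else fun x => g (2 * p - x).

Lemma first_harmonic_fold (R : realType) (p : R) g :
  first_harmonic g -> first_harmonic (fold_at p g).
Proof.
move=> gH; rewrite /fold_at; case: ifP => // _ x s.
have := gH (2 * p - x) (- s); rewrite sinN.
rewrite (_ : 2 * p - x + - s = 2 * p - (x + s)); last by ring.
rewrite (_ : 2 * p - x - - s = 2 * p - (x - s)); last by ring.
rewrite (_ : 2 * p - x + pi / 2 = 2 * p - (x - pi / 2)); last by ring.
rewrite (_ : 2 * p - x - pi / 2 = 2 * p - (x + pi / 2)); last by ring.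
by move=> ->; ring.
Qed.

(** Splitting [D] into its negative and positive parts makes each correction a function of [g] times
    a function of [s], hence a term of rank one. *)
Lemma foldE (R : realType) (p : R) g s : first_harmonic g ->
  let D := g (p + pi / 2) - g (p - pi / 2) in
  g (p + s) = fold_at p g (p + `|s|)
    + (Num.max (- D) 0 * (if s < 0 then sin `|s| else 0)
       + Num.max D 0 * (if s < 0 then 0 else sin `|s|)).
Proof.
move=> gH D; have := gH p s; rewrite -/D /fold_at -subr_le0 -/D => gs.
have fp : 2 * p - (p + `|s|) = p - `|s| by ring.
case: (leP D 0) => D0.
  have -> : Num.max (- D) 0 = - D by apply/max_idPl; lra.
  by case: ltrP gs => s0; rewrite ?(ltr0_norm s0) ?(ger0_norm s0) ?sinN; lra.
have -> : Num.max (- D) 0 = 0 by apply/max_idPr; lra.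
rewrite fp; case: ltrP gs => s0; rewrite ?(ltr0_norm s0) ?(ger0_norm s0) ?opprK;
  lra.
Qed.

Lemma fold_ge0 (R : realType) (p : R) g s : 0 <= g (p + s) -> 0 <= g (p - s) ->
  0 <= fold_at p g (p + s).
Proof.
rewrite /fold_at; case: ifP => // _ _.
by rewrite (_ : 2 * p - (p + s) = p - s) //; ring.
Qed.

(** Induction on the number [s] of folds, [2 * d] being the angular step. The map [J] may repeat
    points because a fold identifies mirror images. *)
Lemma arc_factorizable (R : realType) (d : R) (c s m : nat) (x0 : R) (f v : nat)
    (g : 'I_f -> R -> R) (J : 'I_v -> nat) :
  0 <= d -> (m <= c * 2 ^ s)%N -> m%:R * d <= pi ->
  (forall i, first_harmonic (g i)) ->
  (forall i l, (l < m)%N -> 0 <= g i (x0 + 2 * l%:R * d)) ->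
  (forall j, (J j < m)%N) ->
  nonneg_factorizable (\matrix_(i, j) g i (x0 + 2 * (J j)%:R * d)) (c + s.*2).
Proof.
move=> d0; elim: s m x0 g J => [|s IHs] m x0 g J lemc mdpi gH g0 Jm.
  rewrite expn0 muln1 in lemc; rewrite addn0.
  (* At most [c] points remain: list the slacks at these points, padded with zero columns, and let
     the right factor select. *)
  exists (\matrix_(i, l) if (l < m)%N then g i (x0 + 2 * l%:R * d) else 0).
  exists (\matrix_(l, j) (l == J j :> nat)%:R).
  split=> [i l|l j|]; rewrite ?mxE.
  - by case: ifP => // /g0.
  - exact: ler0n.
  apply/matrixP=> i j; rewrite !mxE.
  rewrite (bigD1 (Ordinal (leq_trans (Jm j) lemc))) //= !mxE /= Jm eqxx mulr1.
  rewrite big1 ?addr0 // => l lj.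
  by rewrite !mxE (negPf lj : (_ == J j) = _) mulr0.
pose p : R := x0 + (m%:R - 1) * d.
(* Of an index and its mirror image, the larger lies in the upper half, which starts at [m./2] (the
   midpoint itself if [m] is odd). *)
pose K j := (maxn (J j) (m.-1 - J j) - m./2)%N.
pose x1 : R := x0 + 2 * m./2%:R * d.
pose t j : R := (2 * (J j)%:R - (m%:R - 1)) * d.
have m1E : (0 < m)%N -> m%:R - 1 = m.-1%:R :> R.
  by move=> /prednK {1}<-; rewrite -natr1 addrK.
have tE j : p + t j = x0 + 2 * (J j)%:R * d.
  by rewrite /p /t; ring.
have KE j : p + `|t j| = x1 + 2 * (K j)%:R * d.
  have jm := Jm j; rewrite /p /t /x1 /K normrM (ger0_norm d0) m1E; last by lia.
  have -> : `|2 * (J j)%:R - m.-1%:R| =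
      2 * (maxn (J j) (m.-1 - J j))%:R - m.-1%:R :> R.
    case: (leqP (J j) (m.-1 - J j)%N) => le.
      rewrite ler0_norm; last by rewrite subr_le0 -natrM ler_nat; lia.
      by rewrite natrB; [ring|lia].
    by rewrite ger0_norm // subr_ge0 -natrM ler_nat; lia.
  by rewrite natrB; [ring|lia].
have [||i|i l lm|j|U [V [U0 V0 UV]]] :=
  IHs (uphalf m) x1 (fun i => fold_at p (g i)) K.
- by move: lemc; rewrite expnS; lia.
- by apply: le_trans mdpi; rewrite ler_wpM2r // ler_nat; lia.
- exact: first_harmonic_fold.
(* Both the point of the half and its mirror image belong to the old arc, where [g i] is
   nonnegative. *)
- have -> : x1 + 2 * l%:R * d = p + (2 * (l + m./2)%:R - m.-1%:R) * d.
    by rewrite /x1 /p m1E ?natrD; [ring|lia].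
  apply: fold_ge0.
    have -> : p + (2 * (l + m./2)%:R - m.-1%:R) * d =
        x0 + 2 * (l + m./2)%:R * d.
      by rewrite /p m1E; [ring|lia].
    by apply: g0; lia.
  have -> : p - (2 * (l + m./2)%:R - m.-1%:R) * d =
      x0 + 2 * (m.-1 - (l + m./2))%:R * d.
    by rewrite /p m1E ?natrB; [ring|lia|lia].
  by apply: g0; lia.
- by have := Jm j; rewrite /K; lia.
(* No point is further than [(m - 1) * d <= pi] from the mid-angle. *)
have sin0 j : 0 <= sin `|t j|.
  apply: sin_ge0_pi; rewrite normr_ge0 /=; apply: le_trans mdpi.
  have jm := Jm j; rewrite /t normrM (ger0_norm d0) ler_wpM2r // m1E; last by lia.
  rewrite ler_norml -natrM; apply/andP; split.
    by rewrite lerNl opprB lerBlDr -natrD ler_nat; lia.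
  by rewrite lerBlDr -natrD ler_nat; lia.
pose D i := g i (p + pi / 2) - g i (p - pi / 2).
have -> : (c + s.+1.*2 = c + s.*2 + (1 + 1))%N by lia.
exists (row_mx U (row_mx (\col_i Num.max (- D i) 0) (\col_i Num.max (D i) 0))).
exists (col_mx V (col_mx (\row_j (if t j < 0 then sin `|t j| else 0))
                         (\row_j (if t j < 0 then 0 else sin `|t j|)))).
split=> [i l|l j|].
- rewrite mxE; case: (fintype.split _) => // {}l.
  by rewrite mxE; case: (fintype.split _) => {}l; rewrite mxE le_max lexx orbT.
- rewrite mxE; case: (fintype.split _) => // {}l.
  by rewrite mxE; case: (fintype.split _) => {}l; rewrite mxE; case: ifP.
rewrite !mul_row_col -UV; apply/matrixP => i j.
by rewrite !(mxE, big_ord1) -tE (foldE _ _ (gH i)) KE.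
Qed.

Lemma dotp_circle_pt (R : realType) (a z : 'cV[R]_2) (r t : R) :
  dotp a (circle_pt z r t) =
    dotp a z + r * a 0 0 * cos t + r * a 1 0 * sin t.
Proof.
rewrite /dotp !(mxE, big_ord_recl, big_ord0) /=.
have -> : lift ord0 ord0 = 1 :> 'I_2 by apply/val_inj.
by have -> : ord0 = 0 :> 'I_2 by []; ring.
Qed.

Lemma mem_conv_hull (R : realType) d n (p : 'I_n -> 'cV[R]_d) i :
  conv_hull p (p i).
Proof.
exists (fun j => (j == i)%:R); split=> [j||]; first exact: ler0n.
  by rewrite (bigD1 i) //= eqxx big1 ?addr0 // => j /negPf ->.
rewrite (bigD1 i) //= eqxx scale1r big1 ?addr0 // => j /negPf ->.
by rewrite scale0r.
Qed.

Lemma dotp_sum (R : realType) d n (a : 'cV[R]_d) (c : 'I_n -> R)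
    (p : 'I_n -> 'cV[R]_d) :
  dotp a (\sum_i c i *: p i) = \sum_i c i * dotp a (p i).
Proof.
rewrite /dotp mulmx_sumr summxE; apply: eq_bigr => i _.
by rewrite -scalemxAr mxE.
Qed.

(** Write [x] as a convex combination: the weighted slacks sum to zero, so a point of nonzero weight
    is tight and must be [x]. *)
Lemma vertex_conv_hull (R : realType) d n (p : 'I_n -> 'cV[R]_d) x :
  vertex (conv_hull p) x -> exists i, x = p i.
Proof.
case=> a [b [ab xE]].
have [[c [c0 c1 xc]] axb] : tight_set (conv_hull p) a b x by rewrite -xE.
have slack0 i : 0 <= b - dotp a (p i).
  by rewrite subr_ge0; apply: ab; exact: mem_conv_hull.
have sum0 : \sum_i c i * (b - dotp a (p i)) = 0.
  under eq_bigr do rewrite mulrBr.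
  by rewrite sumrB -mulr_suml c1 mul1r -dotp_sum -xc axb subrr.
have [i ci] : exists i, c i != 0.
  apply: contrapT => nc; move: c1; rewrite big1 => [/esym/eqP|i _].
    by rewrite oner_eq0.
  by apply/eqP/negPn/negP => ci; apply: nc; exists i.
exists i; apply: esym.
have : tight_set (conv_hull p) a b (p i); last by rewrite -xE.
split; first exact: mem_conv_hull.
have /(_ i isT)/eqP := psumr_eq0P (fun j _ => mulr_ge0 (c0 j) (slack0 j)) sum0.
by rewrite mulf_eq0 (negPf ci) subr_eq0 => /eqP.
Qed.

(** The whole polygon is an arc of [n] points with [d = pi / n], the extreme case [n * d = pi]. *)
Lemma regular_ngon_rank (R : realType) (n c s : nat) (z : 'cV[R]_2) (r t : R)
    (f v : nat) (S : 'M[R]_(f, v)) :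
  (0 < n)%N -> slack_matrix (regular_ngon n z r t) S ->
  (n <= c * 2 ^ s)%N -> (nonneg_rank S <= c + s.*2)%N.
Proof.
move=> n0 [a [b [x [ab _ [x_vertex _ _] SE]]]] nc.
have angleE (l : nat) :
  t + 2 * pi * l%:R / n%:R = t + 2 * l%:R * (pi / n%:R) by ring.
have /choice [J xJ] j : exists l : 'I_n,
    x j = circle_pt z r (t + 2 * l%:R * (pi / n%:R)).
  by have [l ->] := vertex_conv_hull (x_vertex j I); exists l; rewrite angleE.
pose g i u := b i - dotp (a i) (circle_pt z r u).
have g0 i l : (l < n)%N -> 0 <= g i (t + 2 * l%:R * (pi / n%:R)).
  move=> ln; rewrite subr_ge0; apply: ab; rewrite -angleE.
  exact: (mem_conv_hull _ (Ordinal ln)).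
have SgE : S = \matrix_(i, j) g i (t + 2 * (J j)%:R * (pi / n%:R)).
  by apply/matrixP=> i j; rewrite SE mxE xJ.
have [] // := @nonneg_rankP _ _ _ S.
  by move=> i j; rewrite SgE mxE; exact: g0.
move=> _; apply; rewrite SgE; apply: (arc_factorizable _ nc) => //.
- by rewrite divr_ge0 ?pi_ge0.
- by rewrite mulrCA divff ?mulr1 // pnatr_eq0 -lt0n.
move=> i y w; rewrite /g !dotp_circle_pt.
have := first_harmonic_trig (r * a i 0 0) (r * a i 1 0) (b i - dotp (a i) z) y w.
by lra.
Qed.

Lemma ceil_log2 (R : realType) (n k : nat) : (2 ^ k < n <= 2 ^ k.+1)%N ->
  Num.ceil (log2 (n%:R : R)) = k.+1.
Proof.
case/andP=> kn nk; have ln2 : 0 < ln 2 :> R by rewrite ln_gt0 ?ltr1n.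
have n0 : 0 < n%:R :> R by rewrite ltr0n; apply: leq_ltn_trans kn.
have pow m : ln 2 *+ m = ln (2 ^ m)%:R :> R by rewrite natrX lnXn.
have pos m : 0 < (2 ^ m)%:R :> R by rewrite ltr0n expn_gt0.
apply: ceil_def; rewrite /log2 -addn1 PoszD addrK.
rewrite ltr_pdivlMr // ler_pdivrMr // -!pmulrn !mulr_natl !pow.
by rewrite ltr_ln // ?ler_ln // ?posrE // ltr_nat ler_nat kn addn1.
Qed.

Theorem theorem3 (R : realType) (n : nat) (hn : (2 <= n)%N)
    (z : 'cV[R]_2) (r t : R) (hr : 0 < r)
    (f v : nat) (S : 'M[R]_(f, v)) (hS : slack_matrix (regular_ngon n z r t) S)
    (k : int) (hk : (2 : R) ^ (k - 1) < n%:R <= (2 : R) ^ k) :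
  ((2 : R) ^ (k - 1) < n%:R <= (2 : R) ^ (k - 1) + (2 : R) ^ (k - 2) ->
     (nonneg_rank S)%:Z <= 2 * Num.ceil (log2 (n%:R : R)) - 1 /\
     2 * Num.ceil (log2 (n%:R : R)) - 1 = 2 * k - 1) /\
  ((2 : R) ^ (k - 1) + (2 : R) ^ (k - 2) < n%:R <= (2 : R) ^ k ->
     (nonneg_rank S)%:Z <= 2 * Num.ceil (log2 (n%:R : R)) /\
     2 * Num.ceil (log2 (n%:R : R)) = 2 * k).
Proof.
have n0 : (0 < n)%N by apply: leq_trans hn.
have [m kE] : exists m : nat, k = m.+1.
  case: k hk => [[|m]|m] /andP[_ nk]; last first.
  - move: nk; rewrite leNgt NegzE -exprnN => /negP[].
    rewrite (@lt_le_trans _ _ 1) ?ler1n //.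
    by rewrite invf_lt1 ?exprn_gt0 // exprn_egt1 ?ltr1n.
  - by exists m.
  - by move: nk; rewrite expr0z lern1 leqNgt hn.
have k1 : k - 1 = m by rewrite kE -addn1 PoszD addrK.
have kn : (2 ^ m < n <= 2 ^ m.+1)%N.
  by move: hk; rewrite k1 kE -!exprnP -!natrX ltr_nat ler_nat.
rewrite (ceil_log2 R kn) -kE; split=> [/andP[_ n_le]|_]; split=> //.
  case: m kE k1 kn => [|m] kE k1 kn.
    (* For [k = 1] the first range would force [n <= 3/2]. *)
    exfalso; have n2 : 2 <= n%:R :> R by rewrite ler_nat.
    move: n_le; rewrite k1 (_ : k - 2 = -1); last by rewrite kE.
    by rewrite expr0z exprN1; lra.
  have k2 : k - 2 = m by rewrite kE; lia.
  (* Now [k = m + 2], and stopping at three points after [m] folds costs [3 + 2 * m = 2 * k - 1]. *)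
  have /(regular_ngon_rank n0 hS) : (n <= 3 * 2 ^ m)%N.
    move: n_le; rewrite k1 k2 -!exprnP -!natrX -natrD ler_nat expnS; lia.
  by rewrite kE; lia.
(* Here [k = m + 1], and stopping at two points costs [2 + 2 * m = 2 * k]. *)
have /(regular_ngon_rank n0 hS) : (n <= 2 * 2 ^ m)%N.
  by rewrite -expnS; case/andP: kn.
by rewrite kE; lia.
Qed.
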